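(* Let $\eta\in\mathbb N\cup\{\infty\}$ and $\kappa\in\mathbb Z_+$, let $X=X_{\eta,\kappa}$ and $\phi=\phi_{\eta,\kappa}$ be the set and self-map described in the context, and let $\mu$ be a discrete measure on $X$ such that the composition operator $C_\phi$ in $L^2(\mu)$ is densely defined. Then the following assertions hold. (i) If $\{P(x,\cdot)\}_{x\in X}$ is a family of Borel probability measures on $\mathbb R_+$ that satisfies the consistency condition (CC), then (i-a) $\{\mathsf h_{\phi^n}(x_{i,1})\}_{n=0}^\infty$ is a Stieltjes moment sequence for every $i\in J_\eta$, (i-b) for every $i\in J_\eta$, the measure $P(x_{i,1},\cdot)$ is an S-representing measure of $\{\mathsf h_{\phi^n}(x_{i,1})\}_{n=0}^\infty$ vanishing on $[0,1]$, (i-c) $\sum_{i=1}^{\eta}\frac{\mu(x_{i,1})}{\mu(x_r)}\int_0^\infty\frac{t^r-1}{t^{\kappa+1}-1}P(x_{i,1},dt)+\frac{\mu(x_0)}{\mu(x_r)}=1$ for every $r\in J_\kappa$, (i-d) $\sum_{i=1}^{\eta}\frac{\mu(x_{i,1})}{\mu(x_0)}\int_0^\infty\frac1{t^{\kappa+1}-1}P(x_{i,1},dt)\le1$. (ii) If (i-a) holds and $\{P(x_{i,1},\cdot)\}_{i\in J_\eta}$ is a family of Borel probability measures on $\mathbb R_+$ satisfying (i-b), (i-c) and (i-d), then there exists a family $\{P(x,\cdot)\}_{x\in X\setminus\{x_{i,1}:i\in J_\eta\}}$ of Borel probability measures on $\mathbb R_+$ such that $\{P(x,\cdot)\}_{x\in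 X}$ satisfies (CC).
   Context: Notation: $\mathbb N=\{1,2,\ldots\}$, $\mathbb Z_+=\{0,1,2,\ldots\}$, $\mathbb R_+=[0,\infty)$, $J_k=\{i\in\mathbb N:i\le k\}$ for $k\in\mathbb Z_+\cup\{\infty\}$ ($J_0=\emptyset$, $J_\infty=\mathbb N$); $0^0=1$; $\int_0^\infty$ means $\int_{[0,\infty)}$. All measures are positive. Integrals with denominator $t^{\kappa+1}-1$ are taken with respect to measures vanishing on $[0,1]$, i.e. effectively over $(1,\infty)$. The set and the symbol. $X=X_{\eta,\kappa}=\{x_0,\ldots,x_\kappa\}\cup\{x_{i,j}:i\in J_\eta,\ j\in\mathbb N\}$, all listed points being distinct, and $\phi=\phi_{\eta,\kappa}\colon X\to X$ is given by $\phi(x_{i,j})=x_{i,j-1}$ for $i\in J_\eta$, $j\ge2$; $\phi(x_{i,1})=x_\kappa$ for $i\in J_\eta$; $\phi(x_0)=x_\kappa$; $\phi(x_r)=x_{r-1}$ for $r\in J_\kappa$. Operators. A discrete measure on $X$ is a $\sigma$-finite measure $\mu$ on $2^X$ with $\mu(x):=\mu(\{x\})>0$ for all $x\in X$ (so $\mu(x)<\infty$ as well). The composition operator $C_\phi$ in $L^2(\mu)$ has domain $\{f\in L^2(\mu):f\circ\phi\in L^2(\mu)\}$ and $C_\phi f=f\circ\phi$. For $n\in\mathbb Z_+$, $\mathsf h_{\phi^n}(x)=\mu((\phi^n)^{-1}(\{x\}))/\mu(x)\in[0,\infty]$. Consistency condition. A family $\{P(x,\cdot)\}_{x\in X}$ of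 Borel probability measures on $\mathbb R_+$ satisfies (CC) if $\frac1{\mu(x)}\sum_{y\in\phi^{-1}(\{x\})}\mu(y)P(y,\sigma)=\int_\sigma t\,P(x,dt)$ for every Borel $\sigma\subseteq\mathbb R_+$ and every $x\in\phi(X)$. Moments. A real sequence $\{\gamma_n\}_{n=0}^\infty$ is a Stieltjes moment sequence if there is a Borel measure $\nu$ on $\mathbb R_+$ (an S-representing measure) with all moments finite and $\gamma_n=\int_0^\infty t^n\,d\nu(t)$ for all $n\in\mathbb Z_+$. *)

(* Defs.v *)
(* Library world: MathComp + MathComp-Analysis, over an arbitrary realType. *)
From HB Require Import structures.
From mathcomp Require Import all_boot all_order all_algebra.
From mathcomp Require Import all_classical all_reals all_analysis.
From mathcomp Require Import complex.

Set Warnings "-redundant-canonical-projection".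
Set Implicit Arguments.
Unset Strict Implicit.
Unset Printing Implicit Defensive.

Import Order.TTheory GRing.Theory Num.Theory.
Import numFieldNormedType.Exports.

Local Open Scope classical_set_scope.
Local Open Scope ring_scope.
Local Open Scope ereal_scope.

(* Elements of N u {oo} are encoded by [option nat], with [None] for oo. *)
Definition in_J (k : option nat) (i : nat) : bool :=
  (0 < i)%N && (if k is Some m then (i <= m)%N else true).

Definition J (k : option nat) : Type := {i : nat | in_J k i}.

HB.instance Definition _ (k : option nat) := Countable.on (J k).

(* [inl r] is x_r for 0 <= r <= kappa, and [inr (i, j)] is x_{i,j+1}: the
   second index starts at 1 in x_{i,j}, and at 0 in the encoding. *)
Definition X (eta : option nat) (kappa : nat) : Type :=
  ('I_kappa.+1 + J eta * nat)%type.

Definition trunk {eta : option nat} {kappa : nat} (r : 'I_kappa.+1) :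
  X eta kappa := inl r.

Definition branch {eta : option nat} {kappa : nat} (i : J eta) (j : nat) :
  X eta kappa := inr (i, j).

Definition phi {eta : option nat} {kappa : nat} (x : X eta kappa) :
    X eta kappa :=
  match x with
  | inl r => if r == ord0 then trunk ord_max else trunk (inord r.-1)
  | inr (i, j.+1) => branch i j
  | inr (_, 0%N) => trunk ord_max
  end.

HB.instance Definition _ (eta : option nat) (kappa : nat) :=
  Countable.on (X eta kappa).

HB.instance Definition _ (eta : option nat) (kappa : nat) :=
  isPointed.Build (X eta kappa) (trunk ord0).

(* X carries the sigma-algebra of all its subsets. *)
HB.instance Definition _ (eta : option nat) (kappa : nat) :=
  @isMeasurable.Build default_measure_display (X eta kappa)
    discrete_measurable discrete_measurable0
    discrete_measurableC discrete_measurableU.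

Definition discrete_measure (d : measure_display) (T : measurableType d)
    (R : realType) (mu : {measure set T -> \bar R}) : Prop :=
  sigma_finite [set: T] mu /\ forall x : T, 0 < mu [set x].

(* Used only when every subset of T is measurable and every singleton has
   positive measure: every function is then measurable and a.e. equality is
   equality, so elements of the complex L^2(mu) are plain functions. *)
Definition L2norm (d : measure_display) (T : measurableType d) (R : realType)
    (mu : {measure set T -> \bar R}) (f : T -> complex R) : \bar R :=
  Lnorm mu 2%:E (fun x => (Normc.normc (f x))%:E).

Definition L2 (d : measure_display) (T : measurableType d) (R : realType)
    (mu : {measure set T -> \bar R}) : set (T -> complex R) :=
  [set f | L2norm mu f < +oo].

Definition comp_op_dom (d : measure_display) (T : measurableType d)
    (R : realType) (mu : {measure set T -> \bar R}) (psi : T -> T) :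
    set (T -> complex R) :=
  [set f | L2 mu f /\ L2 mu (f \o psi)].

Definition comp_op_densely_defined (d : measure_display)
    (T : measurableType d) (R : realType) (mu : {measure set T -> \bar R})
    (psi : T -> T) : Prop :=
  forall f, L2 mu f -> forall e : R, (0 < e)%R ->
    exists2 g, comp_op_dom mu psi g & L2norm mu (fun x => f x - g x)%R < e%:E.

Definition h_ (d : measure_display) (T : measurableType d) (R : realType)
    (mu : {measure set T -> \bar R}) (psi : T -> T) (n : nat) (x : T) :
    \bar R :=
  mu (iter n psi @^-1` [set x]) / mu [set x].

(* Borel measures on [0, oo) are encoded as Borel measures on R carried by
   [0, oo). *)
Definition on_Rplus (R : realType)
    (nu : {measure set (measurableTypeR R) -> \bar R}) : Prop :=
  nu `]-oo, 0%R[%classic = 0.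

Definition S_representing (R : realType)
    (nu : {measure set (measurableTypeR R) -> \bar R})
    (gamma : nat -> \bar R) : Prop :=
  on_Rplus nu /\
  forall n, gamma n \is a fin_num /\
    gamma n = \int[nu]_(t in `[0%R, +oo[%classic) (t ^+ n)%:E.

Definition Stieltjes_moment_seq (R : realType) (gamma : nat -> \bar R) :
    Prop :=
  exists nu : {measure set (measurableTypeR R) -> \bar R},
    S_representing nu gamma.

Definition CC (d : measure_display) (T : measurableType d) (R : realType)
    (mu : {measure set T -> \bar R}) (psi : T -> T)
    (P : T -> probability (measurableTypeR R) R) : Prop :=
  forall (x : T) (sigma : set (measurableTypeR R)),
    range psi x -> measurable sigma -> sigma `<=` `[0%R, +oo[%classic ->
    (mu [set x])^-1 *
      (\esum_(y in psi @^-1` [set x]) (mu [set y] * P y sigma))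
    = \int[P x]_(t in sigma) t%:E.

Section Conditions.
Context {eta : option nat} {kappa : nat} {R : realType}.
Variable mu : {measure set (X eta kappa) -> \bar R}.
Variable Q : J eta -> probability (measurableTypeR R) R.

Definition cond_a : Prop :=
  forall i : J eta, Stieltjes_moment_seq (fun n => h_ mu phi n (branch i 0)).

Definition cond_b : Prop :=
  forall i : J eta,
    S_representing (Q i) (fun n => h_ mu phi n (branch i 0)) /\
    Q i `[0%R, 1%R]%classic = 0.

(* The integrands below take the value 0 at t = 1, since 0^-1 = 0 in R; this
   is harmless because the conditions are used for Q i vanishing on [0, 1]. *)
Definition cond_c : Prop :=
  forall r : 'I_kappa.+1, (0 < r)%N ->
    (\esum_(i in [set: J eta])
      (mu [set branch i 0] / mu [set trunk r] *
       \int[Q i]_(t in `[0%R, +oo[%classic)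
          ((t ^+ r - 1) / (t ^+ kappa.+1 - 1))%:E))
    + mu [set trunk ord0] / mu [set trunk r] = 1.

Definition cond_d : Prop :=
  (\esum_(i in [set: J eta])
    (mu [set branch i 0] / mu [set trunk ord0] *
     \int[Q i]_(t in `[0%R, +oo[%classic) ((t ^+ kappa.+1 - 1)^-1)%:E)) <= 1.

End Conditions.

(* Main.v *)
Require Import Defs.
From HB Require Import structures.
From mathcomp Require Import all_boot all_order all_algebra.
From mathcomp Require Import all_classical all_reals all_analysis.
From mathcomp Require Import measurable_realfun.

Import Order.TTheory GRing.Theory Num.Theory.
Import numFieldNormedType.Exports.

Local Open Scope classical_set_scope.
Local Open Scope ring_scope.
Local Open Scope ereal_scope.

(** The tree is made of a trunk, on which [phi] cycles through
    x_kappa, ..., x_0, x_kappa, and of branches that flow into x_kappa.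
    Each point other than x_kappa has exactly one preimage, and there the
    consistency condition says that, up to the ratio of the masses, the measure
    at the preimage is t times the measure at the point.  Iterating along a
    branch gives mu(x_{i,n+1}) P(x_{i,n+1}, dt) = mu(x_{i,1}) t^n P(x_{i,1}, dt),
    and along the trunk mu(x_r) P(x_r, dt) = mu(x_0) t^r P(x_0, dt)
    ([chain_moments]).  Total mass one of the left-hand sides is the moment
    condition on the branches.  The only condition left is the one at
    x_kappa.  With a = mu(x_0), P0 = P(x_0, .) and nu the sum of the measures
    mu(x_{i,1}) P(x_{i,1}, .) over i, it reads ([trunk_equation])
      a P0 + nu = a t^(kappa+1) P0   on [0, oo).

    Analysis of this equation.  On [0, 1] the right-hand side is at most a P0,
    which is finite; so nu vanishes on [0, 1] and P0 on [0, 1).  On (1, oo) the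
    finite measure a P0 can be subtracted, which gives
    nu = a (t^(kappa+1) - 1) P0.  Integrating (t^r - 1)/(t^(kappa+1) - 1)
    against nu thus gives a times the integral of t^r - 1 against P0, that is
    mu(x_r) - mu(x_0); integrating 1/(t^(kappa+1) - 1) gives
    a P0((1, oo)) <= a.

    Conversely, given nu with these properties, the density
    1/(t^(kappa+1) - 1) with respect to nu has total mass at most a, and the
    mass that is missing is put at t = 1, where the factors t^(kappa+1) and 1
    agree: the result is a P0 ([trunk_equation_solution]).  The measures at the
    other points are then forced to be multiples of t^r P0 and of
    t^j P(x_{i,1}, .), and the moment conditions say that they have mass one.

    All integrands are nonnegative, so the computation takes place in
    [0, oo] and subtraction is only used for quantities known to be finite. *)

(** * Densities and sums of measures *)

Section Density.
Context d (T : measurableType d) (R : realType).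
Implicit Types (m nu : {measure set T -> \bar R}) (f : T -> \bar R) (w : T -> R).

Lemma density_measure m w :
  measurable_fun [set: T] w -> (forall x, (0 <= w x)%R) ->
  exists nu : {measure set T -> \bar R},
    forall A, nu A = \int[m]_(x in A) (w x)%:E.
Proof.
move=> mw w0.
pose f A := \int[m]_(x in A) (w x)%:E.
have f0 : f set0 = 0 by exact: integral_set0.
have f_ge0 A : 0 <= f A by apply: integral_ge0 => x _; rewrite lee_fin.
have f_add : semi_sigma_additive f.
  apply: semi_sigma_additive_nng_induced; first exact/measurable_EFinP.
  by move=> x; rewrite lee_fin.
pose M := isMeasure.Build d T R f f0 f_ge0 f_add.
pose nu : {measure set T -> \bar R} := HB.pack f M.
by exists nu.
Qed.

Import HBNNSimple.

(** Both sides agree for simple functions, since they agree for indicators of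
    measurable subsets of [D]; monotone convergence does the rest.  The
    hypothesis concerns subsets of [D] only, because at the junction [nu] has a
    nonnegative density on (1, oo) and not on the whole line. *)
Lemma ge0_integral_density m nu D w f : measurable D ->
  measurable_fun D w -> (forall x, D x -> (0 <= w x)%R) ->
  (forall A, measurable A -> A `<=` D -> nu A = \int[m]_(x in A) (w x)%:E) ->
  measurable_fun D f -> (forall x, D x -> 0 <= f x) ->
  \int[nu]_(x in D) f x = \int[m]_(x in D) (f x * (w x)%:E).
Proof.
move=> mD mw w0 nuE mf f0.
have mw' : measurable_fun D (EFin \o w) by exact/measurable_EFinP.
pose f_ := nnsfun_approx mD mf.
have step (h : {nnsfun T >-> R}) :
    \int[nu]_(x in D) (h x)%:E = \int[m]_(x in D) ((h x)%:E * (w x)%:E).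
  have mpiece r : measurable_fun D (fun x => (r * \1_(h @^-1` [set r]) x)%:E).
    exact/measurable_EFinP/measurable_funTS/measurableT_comp.
  under eq_integral do rewrite fimfunE -fsumEFin//.
  rewrite ge0_integral_fsum//; last first.
    by move=> r x _; rewrite EFinM nnfun_muleindic_ge0.
  under [RHS]eq_integral => x xD.
    rewrite fimfunE -fsumEFin// ge0_mule_fsuml; last first.
      by move=> r; rewrite EFinM nnfun_muleindic_ge0.
    over.
  rewrite [RHS]ge0_integral_fsum//; last 2 first.
  - by move=> r; exact: emeasurable_funM.
  - by move=> r x Dx; apply: mule_ge0; [rewrite EFinM nnfun_muleindic_ge0 | rewrite lee_fin w0].
  apply: eq_fsbigr => r _.
  have [r0|r0] := leP 0%R r; last first.
    rewrite !integral0_eq// => x Dx.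
      by rewrite preimage_nnfun0// indicE in_set0 mulr0 mul0e.
    by rewrite preimage_nnfun0// indicE in_set0 mulr0.
  under eq_integral do rewrite EFinM.
  under [RHS]eq_integral do rewrite EFinM -muleA.
  have mI : measurable_fun D (fun x => (\1_(h @^-1` [set r]) x : R)%:E).
    exact/measurable_EFinP/measurable_funTS/measurable_indic.
  rewrite ge0_integralZl_EFin//.
  rewrite ge0_integralZl_EFin//; last 2 first.
  - by move=> x Dx; rewrite mule_ge0 ?lee_fin ?w0.
  - exact: emeasurable_funM.
  congr (_ * _); rewrite integral_indic// nuE//; last exact: measurableI.
  rewrite setIC integral_mkcondr; apply: eq_integral => x _.
  by rewrite epatch_indic muleC.
transitivity (limn (fun n => \int[nu]_(x in D) (f_ n x)%:E)).
  rewrite -monotone_convergence//=.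
  - apply: eq_integral => x /[!inE] xD; apply/esym/cvg_lim => //=.
    exact: cvg_nnsfun_approx.
  - by move=> n; apply/measurable_EFinP/measurable_funTS.
  - by move=> n x _; rewrite lee_fin.
  - by move=> x _ a b ab; rewrite lee_fin//; exact/lefP/nd_nnsfun_approx.
under eq_fun do rewrite step.
rewrite -monotone_convergence//=.
- apply: eq_integral => x /[!inE] xD.
  by apply/cvg_lim => //=; apply: cvgeZr => //; exact: cvg_nnsfun_approx.
- move=> n; apply: emeasurable_funM => //; exact/measurable_EFinP/measurable_funTS.
- by move=> n x Dx; rewrite mule_ge0 ?lee_fin ?w0// lee_fin.
- move=> x Dx a b ab; apply: lee_wpmul2r; first by rewrite lee_fin w0.
  by rewrite lee_fin//; exact/lefP/nd_nnsfun_approx.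
Qed.

End Density.

Section SumOfMeasures.
Context d (T : measurableType d) (R : realType) (I : countType).

Lemma esum_pickle (a : I -> \bar R) : (forall i, 0 <= a i) ->
  \esum_(i in [set: I]) a i =
  \sum_(n <oo) (if pickle_inv n is Some i then a i else 0).
Proof.
move=> a0; rewrite nneseries_esumT; last by move=> n; case: pickle_inv.
rewrite (esumID (range (@pickle I))); last by move=> n; case: pickle_inv.
rewrite [X in _ + X]esum1 ?adde0; last first.
  move=> n [_ /= nI]; case E: (pickle_inv n) => [i|//].
  by case: nI; exists i => //; move: (@pickle_invK I n); rewrite E.
rewrite setTI esum_image; last first.
  by move=> i j _ _; exact: (pcan_inj (@pickleK_inv I)).
by apply: eq_esum => i _; rewrite pickleK_inv.
Qed.

(** The index type is countable, so the sum of the measures is a series of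
    measures along the enumeration [pickle_inv], padded with zero measures. *)
Lemma esum_measure (m : I -> {measure set T -> \bar R}) :
  exists nu : {measure set T -> \bar R},
    (forall A, nu A = \esum_(i in [set: I]) m i A) /\
    forall D f, measurable D -> measurable_fun D f ->
      (forall x, D x -> 0 <= f x) ->
      \int[nu]_(x in D) f x = \esum_(i in [set: I]) \int[m i]_(x in D) f x.
Proof.
pose m' n : {measure set T -> \bar R} :=
  if pickle_inv n is Some i then m i else mzero.
exists (mseries m' 0); split => [A|D f mD mf f0].
  rewrite esum_pickle// /mseries; apply: eq_eseriesr => n _.
  by rewrite /m'; case: pickle_inv.
rewrite ge0_integral_measure_series// esum_pickle; last first.
  by move=> i; exact: integral_ge0.
apply: eq_eseriesr => n _; rewrite /m'; case: pickle_inv => //.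
by rewrite integral_measure_zero.
Qed.

End SumOfMeasures.

Section ScaledDensity.
Context d (T : measurableType d) (R : realType).
Implicit Types (m nu : {measure set T -> \bar R}) (f : T -> \bar R) (w : T -> R).

(** Constants on both sides avoid dividing in the extended reals when the
    constants are masses of points. *)
Lemma ge0_integral_density_scale m nu D w (a b : R) : (0 <= a)%R -> (0 < b)%R ->
  measurable D -> measurable_fun D w -> (forall x, D x -> (0 <= w x)%R) ->
  (forall A, measurable A -> A `<=` D ->
     b%:E * nu A = a%:E * \int[m]_(x in A) (w x)%:E) ->
  forall f, measurable_fun D f -> (forall x, D x -> 0 <= f x) ->
  b%:E * \int[nu]_(x in D) f x = a%:E * \int[m]_(x in D) (f x * (w x)%:E).
Proof.
move=> a0 b0 mD mw w0 nuE f mf f0.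
have mw' : measurable_fun D (EFin \o w) by exact/measurable_EFinP.
rewrite (@ge0_integral_density _ _ _ m nu D (fun x => b^-1 * a * w x)%R)//.
- rewrite -!ge0_integralZl_EFin//.
  + apply: eq_integral => x _; rewrite [in RHS]muleA [in RHS](muleC _ (f x)) -[in RHS]muleA.
    rewrite [LHS]muleCA -!EFinM; congr (_ * _%:E).
    by rewrite !mulrA mulfV ?mul1r// gt_eqF.
  + by move=> x Dx; rewrite mule_ge0 ?f0 ?lee_fin ?w0.
  + exact: emeasurable_funM.
  + move=> x Dx; rewrite mule_ge0 ?f0// lee_fin !mulr_ge0 ?w0// invr_ge0 ltW//.
  + by apply: emeasurable_funM => //; apply/measurable_EFinP/measurable_funM.
  + exact: ltW.
- by apply: measurable_funM.
- by move=> x Dx; rewrite !mulr_ge0 ?w0// invr_ge0 ltW.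
- move=> A mA AD; have b0' : (b != 0)%R by rewrite gt_eqF.
  have -> : nu A = b^-1%:E * (b%:E * nu A) by rewrite muleA -EFinM mulVf ?mul1e.
  rewrite nuE// muleA -EFinM -ge0_integralZl_EFin//.
  + by move=> x Ax; rewrite lee_fin w0//; exact: AD.
  + exact: measurable_funS mw'.
  + by rewrite mulr_ge0// invr_ge0 ltW.
Qed.

Lemma measure_probability (m : {measure set T -> \bar R}) : m [set: T] = 1 ->
  exists P : probability T R, forall A, P A = m A.
Proof.
move=> m1.
have [[x _]|T0] := pselect ([set: T] !=set0); last first.
  have T0' : [set: T] = set0 by apply/eqP/negPn; apply: contra_notN T0 => /set0P.
  by move/eqP: m1; rewrite T0' measure0 eq_sym onee_eq0.
exists (mnormalize m (dirac x)) => A.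
by rewrite /= /mnormalize m1 onee_eq0/= invr1 mule1.
Qed.

End ScaledDensity.

(** * Multiplying a measure on the half-line by powers *)

Section HalfLine.
Context {R : realType}.
Local Notation BR := (measurableTypeR R).
Implicit Types (m nu : {measure set BR -> \bar R}) (P : probability BR R).

Lemma on_Rplus_setT m : on_Rplus m -> m [set: BR] = m `[0%R, +oo[%classic.
Proof.
rewrite /on_Rplus => m0; rewrite -[RHS]add0e -m0 -measureU//.
  congr (m _); apply/seteqP; split => // t _ /=; rewrite !in_itv/= andbT.
  by case: ltP; [left|right].
by apply/seteqP; split => // t [] /=; rewrite !in_itv/= andbT leNgt => ->.
Qed.

Lemma measurable_invr (D : set BR) : measurable_fun D (@GRing.inv R : BR -> BR).
Proof.
apply: (@measurable_funS _ _ _ _ setT) => //.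
rewrite -(setUv [set 0%R]); apply/measurable_funU => //.
  by apply: measurableC.
split; first exact: measurable_fun_set1.
apply: open_continuous_measurable_fun.
  by rewrite openC; exact: closed_eq.
by move=> x /[!inE]/= /eqP x0; exact: inv_continuous.
Qed.

Lemma measurable_exprB1 n (D : set BR) :
  measurable_fun D (fun t : BR => t ^+ n - 1 : R)%R.
Proof. by apply: measurable_funB => //; exact: exprn_measurable. Qed.

Lemma measurable_quot r k (D : set BR) :
  measurable_fun D (fun t : BR => (t ^+ r - 1) / (t ^+ k - 1) : R)%R.
Proof.
apply: measurable_funM; first exact: measurable_exprB1.
apply: measurableT_comp; first exact: measurable_invr.
exact: measurable_exprB1.
Qed.

Lemma measurable_inv_exprB1 k (D : set BR) :
  measurable_fun D (fun t : BR => (t ^+ k - 1)^-1 : R)%R.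
Proof. by apply: measurableT_comp; [exact: measurable_invr|exact: measurable_exprB1]. Qed.

(** The density is cut off outside [0, oo), so that the result is carried by the
    half-line whatever [m] is on the negative numbers. *)
Lemma tilted_probability m n (a b : R) : (0 <= a)%R -> (0 < b)%R ->
  a%:E * \int[m]_(t in `[0%R, +oo[%classic) (t ^+ n)%:E = b%:E ->
  exists P, on_Rplus P /\
    forall A : set BR, measurable A -> A `<=` `[0%R, +oo[%classic ->
      b%:E * P A = a%:E * \int[m]_(t in A) (t ^+ n)%:E.
Proof.
move=> a0 b0 mass1.
pose w : BR -> R := ((fun t => (b^-1 * a) * t ^+ n)%R \_ `[0%R, +oo[)%classic.
have w_ge0 t : (0 <= w t)%R.
  rewrite /w patchE; case: ifPn => // /[!inE]/=; rewrite in_itv/= andbT => t0.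
  by rewrite !mulr_ge0// ?invr_ge0 ?exprn_ge0// ltW.
have mw : measurable_fun setT w.
  apply/(measurable_restrictT _ _).1 => //.
  by apply: measurable_funM => //; exact: exprn_measurable.
have [nu nuE] := density_measure _ _ _ m w mw w_ge0.
have nuA (A : set BR) : measurable A -> A `<=` `[0%R, +oo[%classic ->
    b%:E * nu A = a%:E * \int[m]_(t in A) (t ^+ n)%:E.
  move=> mA A0; rewrite nuE -!ge0_integralZl_EFin//.
  - apply: eq_integral => t /[!inE] /A0 tp; rewrite /w patchE mem_set//.
    by rewrite -!EFinM !mulrA mulfV ?mul1r// gt_eqF.
  - by move=> t /A0/=; rewrite in_itv/= andbT => t0; rewrite lee_fin exprn_ge0.
  - by apply/measurable_EFinP; exact: exprn_measurable.
  - by move=> t _; rewrite lee_fin.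
  - by apply/measurable_EFinP; apply: measurable_funS mw.
  - exact: ltW.
have nu0 : on_Rplus nu.
  rewrite /on_Rplus nuE integral0_eq// => t /=; rewrite in_itv/= => t0.
  by rewrite /w patchE memNset//= in_itv/= andbT leNgt t0.
have [|P PE] := measure_probability _ _ _ nu.
  rewrite on_Rplus_setT//.
  have := nuA _ (measurable_itv _) (@subset_refl _ _).
  rewrite mass1 => /(congr1 (fun x => b^-1%:E * x)).
  by rewrite muleA -!EFinM mulVf ?mul1e// gt_eqF.
exists P; split; first exact: etrans (PE _) nu0.
by move=> A mA A0; rewrite -nuA//; congr (_ * _); exact: PE.
Qed.

Lemma moments_shift m nu n (a b : R) : (0 <= a)%R -> (0 < b)%R ->
  (forall A : set BR, measurable A -> A `<=` `[0%R, +oo[%classic ->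
     b%:E * nu A = a%:E * \int[m]_(t in A) (t ^+ n)%:E) ->
  forall A : set BR, measurable A -> A `<=` `[0%R, +oo[%classic ->
     b%:E * \int[nu]_(t in A) t%:E = a%:E * \int[m]_(t in A) (t ^+ n.+1)%:E.
Proof.
move=> a0 b0 nuE A mA A0.
rewrite (@ge0_integral_density_scale _ _ _ m nu A (fun t => t ^+ n)%R a b)//.
- by congr (_ * _); apply: eq_integral => t _; rewrite -EFinM exprS.
- by move=> t /A0/=; rewrite in_itv/= andbT => t0; rewrite exprn_ge0.
- by move=> B mB BA; apply: nuE => //; exact: subset_trans A0.
- by move=> t /A0/=; rewrite in_itv/= andbT => t0; rewrite lee_fin.
Qed.

(** Multiplying by t at each step multiplies by t^n after n steps; this treats
    the branches and the trunk at once, whence the bound [N] on the length. *)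
Lemma chain_moments (a : nat -> R) (m : nat -> {measure set BR -> \bar R}) N :
  (forall n, 0 < a n)%R ->
  (forall n (A : set BR), (n < N)%N -> measurable A -> A `<=` `[0%R, +oo[%classic ->
     (a n.+1)%:E * m n.+1 A = (a n)%:E * \int[m n]_(t in A) t%:E) ->
  forall n (A : set BR), (n <= N)%N -> measurable A -> A `<=` `[0%R, +oo[%classic ->
     (a n)%:E * m n A = (a 0%N)%:E * \int[m 0%N]_(t in A) (t ^+ n)%:E.
Proof.
move=> a_gt0 step; elim=> [|n IH] A nN mA A0.
  under eq_integral do rewrite expr0.
  by rewrite integral_cst// mul1e.
rewrite step//; apply: (@moments_shift (m 0%N) (m n) n) => //; first exact: ltW.
by move=> B mB B0; apply: IH => //; exact: ltnW.
Qed.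

End HalfLine.

(** * The equation at the junction of the trunk and the branches *)

Lemma adde_injr {R : realDomainType} (x y z : \bar R) :
  x \is a fin_num -> y + x = z + x -> y = z.
Proof. by move=> xfin /(congr1 (fun u => u - x)); rewrite !addeK. Qed.

Section Trunk.
Context {R : realType} (k : nat) (a : R) (a_gt0 : (0 < a)%R).
Local Notation BR := (measurableTypeR R).
Implicit Types (m nu : {measure set BR -> \bar R}) (P : probability BR R).

(** The consistency condition at x_kappa, after the measures on the trunk have
    been expressed by [P], the one at x_0; [a] is the mass of x_0 and [nu] the
    contribution of the branches. *)
Definition trunk_equation P nu :=
  forall A : set BR, measurable A -> A `<=` `[0%R, +oo[%classic ->
    a%:E * P A + nu A = a%:E * \int[P]_(t in A) (t ^+ k.+1)%:E.

Let gt1_ge0 : (`]1%R, +oo[%classic : set BR) `<=` `[0%R, +oo[%classic.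
Proof.
by move=> t /=; rewrite !in_itv/= !andbT => /ltW; exact: le_trans.
Qed.

Let exprB1_ge0 n (t : R) : `]1%R, +oo[%classic t -> (0 <= t ^+ n - 1)%R.
Proof. by rewrite /= in_itv/= andbT => t1; rewrite subr_ge0 exprn_ege1// ltW. Qed.

Let exprB1_gt0 (t : R) : `]1%R, +oo[%classic t -> (0 < t ^+ k.+1 - 1)%R.
Proof. by rewrite /= in_itv/= andbT => t1; rewrite subr_gt0 exprn_egt1. Qed.

(** [f] may be negative on [0, 1], as 1/(t^(k+1) - 1) is, and the interval
    cannot be dropped by the additivity of integrals of nonnegative functions;
    almost everywhere equality of the two integrands handles signs. *)
Lemma integral_gt1 m (f : BR -> \bar R) : m `[0%R, 1%R]%classic = 0 ->
  measurable_fun setT f ->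
  \int[m]_(t in `[0%R, +oo[%classic) f t =
  \int[m]_(t in `]1%R, +oo[%classic) f t.
Proof.
move=> m01 mf.
rewrite -[in RHS](setIidr gt1_ge0) integral_mkcondr.
apply: ae_eq_integral => //.
- exact: measurable_funTS.
- by apply: measurable_funTS; apply/(measurable_restrictT _ _).1 => //; exact: measurable_funTS.
exists `[0%R, 1%R]%classic; split => //.
move=> t /= /not_implyP [t0]; rewrite patchE; case: ifPn => [//|].
rewrite notin_setE/= in_itv/= andbT => /negP; rewrite -leNgt => t1 _.
by move: t0; rewrite /= !in_itv/= t1 !andbT.
Qed.

Section FromEquation.
Variables (P : probability BR R) (nu : {measure set BR -> \bar R}).
Hypothesis (P_ge0 : on_Rplus P) (PnuE : trunk_equation P nu).

(** On [0, 1] one has t^(k+1) <= 1, so the equation gives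
    a * (integral of 1 - t^(k+1) against P) + nu = 0 there, once the finite
    integral of t^(k+1) is cancelled. *)
Lemma trunk_equation_le1 :
  nu `[0%R, 1%R]%classic = 0 /\ P `[0%R, 1%R[%classic = 0.
Proof.
set I : set BR := `[0%R, 1%R]%classic.
have mI : measurable I by exact: measurable_itv.
have I0 : I `<=` `[0%R, +oo[%classic.
  by move=> t /=; rewrite !in_itv/= andbT => /andP[].
have f0 t : I t -> (0 <= 1 - t ^+ k.+1)%R.
  by rewrite /I/= in_itv/= => /andP[t0 t1]; rewrite subr_ge0 exprn_ile1.
have mX n : measurable_fun I (fun t : BR => (t ^+ n)%:E).
  by apply/measurable_EFinP; exact: exprn_measurable.
have mf : measurable_fun I (fun t : BR => (1 - t ^+ k.+1)%:E).
  by apply/measurable_EFinP; apply: measurable_funB.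
have X0 t : I t -> 0 <= (t ^+ k.+1)%:E.
  by rewrite /I/= in_itv/= => /andP[t0 t1]; rewrite lee_fin exprn_ge0.
have PI : P I = \int[P]_(t in I) (1 - t ^+ k.+1)%:E
              + \int[P]_(t in I) (t ^+ k.+1)%:E.
  rewrite -ge0_integralD//.
  rewrite -[LHS]mul1e -integral_cst//; apply: eq_integral => t _ /=.
  by rewrite -EFinD subrK.
have Pfin : a%:E * \int[P]_(t in I) (t ^+ k.+1)%:E \is a fin_num.
  rewrite fin_numM// ge0_fin_numE; last exact: integral_ge0.
  apply: (@le_lt_trans _ _ (P I)); last by rewrite (le_lt_trans (probability_le1 _ _))// ltry.
  by rewrite PI leeDr// integral_ge0.
have := PnuE _ mI I0.
rewrite PI ge0_muleDr ?integral_ge0// addeAC -[RHS]add0e.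
move=> /(adde_injr _ _ _ Pfin) /eqP.
rewrite padde_eq0; last 2 first.
- by rewrite mule_ge0 ?integral_ge0// lee_fin ltW.
- by [].
move=> /andP[/eqP Pf0 /eqP nu0]; split => //.
have {Pf0} : \int[P]_(t in I) `|(1 - t ^+ k.+1)%:E| = 0.
  move/eqP: Pf0; rewrite mule_eq0 eqe gt_eqF//= => /eqP Pf0; rewrite -[RHS]Pf0.
  by apply: eq_integral => t /[!inE] It; rewrite /= ger0_norm// f0.
move/(ae_eq_integral_abs P mI mf).1 => [N [mN PN0 sub]].
apply: (subset_measure0 _ mN) => //.
move=> t /=; rewrite in_itv/= => /andP[t0 t1]; apply: sub => /= H.
have /H/eqP : I t by rewrite /I/= in_itv/= t0 ltW.
by rewrite eqe subr_eq0 gt_eqF// exprn_ilt1.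
Qed.

(** On (1, oo) the term [a%:E * P A] is finite and can be cancelled, and the
    density t^(k+1) - 1 that remains is nonnegative. *)
Lemma trunk_equation_density (f : BR -> \bar R) :
  measurable_fun (`]1%R, +oo[%classic : set BR) f ->
  (forall t, `]1%R, +oo[%classic t -> 0 <= f t) ->
  \int[nu]_(t in `]1%R, +oo[%classic) f t =
  a%:E * \int[P]_(t in `]1%R, +oo[%classic) (f t * (t ^+ k.+1 - 1)%:E).
Proof.
move=> mf f0; rewrite -[LHS]mul1e.
apply: ge0_integral_density_scale => //.
- exact: ltW.
- exact: measurable_exprB1.
- by move=> t; exact: exprB1_ge0.
move=> A mA A1; rewrite mul1e.
have PAfin : a%:E * P A \is a fin_num by rewrite fin_numM// fin_num_measure.
apply: (adde_injr _ _ _ PAfin).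
rewrite addeC PnuE//; last exact: subset_trans gt1_ge0.
rewrite -[P A in RHS]mul1e -integral_cst// -ge0_muleDr ?integral_ge0//; last first.
  by move=> t /A1 /exprB1_ge0; rewrite lee_fin.
rewrite -ge0_integralD//; last 2 first.
- by move=> t /A1 /exprB1_ge0; rewrite lee_fin.
- by apply/measurable_EFinP; exact: measurable_exprB1.
congr (_ * _); apply: eq_integral => t _ /=.
by rewrite -EFinD subrK.
Qed.

(** [P] does not charge [0, 1), so only the atom at 1 and (1, oo) count. *)
Lemma integral_trunk (f : BR -> \bar R) :
  measurable_fun setT f -> (forall t, (0 <= t)%R -> 0 <= f t) ->
  \int[P]_(t in `[0%R, +oo[%classic) f t =
  f 1%R * P [set 1%R] + \int[P]_(t in `]1%R, +oo[%classic) f t.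
Proof.
move=> mf f0; have [_ P01] := trunk_equation_le1.
rewrite (@ge0_negligible_integral _ _ _ P _ `[0%R, 1%R[%classic)//; last 2 first.
- exact: measurable_funTS.
- by move=> t /=; rewrite in_itv/= andbT; exact: f0.
rewrite (_ : _ `\` _ = [set 1%R] `|` `]1%R, +oo[%classic); last first.
  apply/seteqP; split => t /=; rewrite !in_itv/= !andbT.
    move=> [-> /=] /negP; rewrite -leNgt le_eqVlt => /predU1P[->|]; first by left.
    by right.
  move=> [->|t1]; first by rewrite ler01 ltxx.
  by rewrite (le_trans ler01 (ltW t1)) /= ltNge (ltW t1).
rewrite ge0_integral_setU//.
- congr (_ + _); rewrite -integral_cst//; apply: eq_integral => t.
  by rewrite inE/= => ->.
- exact: measurable_funTS.
- move=> t [->|/gt1_ge0/=]; first exact: f0.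
  by rewrite in_itv/= andbT; exact: f0.
- apply/disj_setPLR => t -> /=; rewrite in_itv/= ltxx//.
Qed.

(** The integral of t^r - 1 against a P, in a form without subtraction.  It is
    used in both directions of the theorem: to prove the condition on the
    mass of x_r, and to find the total mass of t^r P from it. *)
Lemma trunk_equation_moment r :
  \int[nu]_(t in `]1%R, +oo[%classic) ((t ^+ r - 1) / (t ^+ k.+1 - 1))%:E + a%:E
  = a%:E * \int[P]_(t in `[0%R, +oo[%classic) (t ^+ r)%:E.
Proof.
have aE : a%:E = a%:E * \int[P]_(t in `[0%R, +oo[%classic) (cst 1 t).
  rewrite integral_cst// mul1e -on_Rplus_setT//.
  by rewrite -[LHS]mule1 -(probability_setT P).
rewrite [X in _ + X]aE !integral_trunk//; last 2 first.
- by apply/measurable_EFinP; exact: exprn_measurable.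
- by move=> t t0; rewrite lee_fin exprn_ge0.
rewrite trunk_equation_density; last 2 first.
- by apply/measurable_EFinP; exact: measurable_quot.
- move=> t t1; rewrite lee_fin divr_ge0//; exact: exprB1_ge0.
rewrite -ge0_muleDr; last 2 first.
- apply: integral_ge0 => t t1; rewrite -EFinM lee_fin !mulr_ge0 ?invr_ge0//; exact: exprB1_ge0.
- by rewrite adde_ge0 ?integral_ge0// mule_ge0.
rewrite addeCA; congr (_ * (_ + _)); first by rewrite /= expr1n.
rewrite -ge0_integralD//.
- apply: eq_integral => t /[!inE] t1.
  by rewrite -EFinM divfK ?gt_eqF ?exprB1_gt0// -EFinD subrK.
- by move=> t t1; rewrite -EFinM lee_fin !mulr_ge0 ?invr_ge0//; exact: exprB1_ge0.
- apply: emeasurable_funM; apply/measurable_EFinP.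
    exact: measurable_quot.
  exact: measurable_exprB1.
Qed.

Lemma trunk_equation_inv :
  \int[nu]_(t in `]1%R, +oo[%classic) ((t ^+ k.+1 - 1)^-1)%:E <= a%:E.
Proof.
rewrite trunk_equation_density; last 2 first.
- by apply/measurable_EFinP; exact: measurable_inv_exprB1.
- by move=> t t1; rewrite lee_fin invr_ge0; exact: exprB1_ge0.
rewrite -[leRHS]mule1; apply: lee_wpmul2l; first by rewrite lee_fin ltW.
rewrite (eq_integral (cst 1)); last first.
  by move=> t /[!inE] t1; rewrite -EFinM mulVf ?gt_eqF ?exprB1_gt0.
by rewrite integral_cst// mul1e; exact: probability_le1.
Qed.

End FromEquation.

(** [rho] has density 1/(a (t^(k+1) - 1)) with respect to [nu] on (1, oo), and
    an atom at 1 that brings its mass up to one.  The atom satisfies the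
    equation by itself because t^(k+1) = 1 at t = 1. *)
Lemma trunk_equation_solution nu : nu `[0%R, 1%R]%classic = 0 ->
  \int[nu]_(t in `]1%R, +oo[%classic) ((t ^+ k.+1 - 1)^-1)%:E <= a%:E ->
  exists P, on_Rplus P /\ trunk_equation P nu.
Proof.
move=> nu01 le_a.
set J := \int[nu]_(t in _) _ in le_a.
have J0 : 0 <= J.
  by apply: integral_ge0 => t t1; rewrite lee_fin invr_ge0; exact: exprB1_ge0.
have Jfin : J \is a fin_num by rewrite ge0_fin_numE// (le_lt_trans le_a)// ltry.
pose w : BR -> R := ((fun t : BR => (t ^+ k.+1 - 1)^-1 : R)%R \_ `]1%R, +oo[)%classic.
have w_ge0 t : (0 <= w t)%R.
  by rewrite /w patchE; case: ifPn => // /[!inE] t1; rewrite invr_ge0 exprB1_ge0.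
have mw : measurable_fun setT w.
  by apply/(measurable_restrictT _ _).1 => //; exact: measurable_inv_exprB1.
have mwE (A : set BR) : measurable_fun A (EFin \o w).
  by apply/measurable_EFinP; apply: measurable_funTS.
have [nu1 nu1E] := density_measure _ _ _ nu w mw w_ge0.
have c_ge0 : (0 <= a - fine J)%R by rewrite subr_ge0 -lee_fin fineK.
have ai_ge0 : (0 <= a^-1)%R by rewrite invr_ge0 ltW.
have divaK x : a%:E * (a^-1%:E * x) = x.
  by rewrite muleA -EFinM mulfV ?mul1e// gt_eqF.
pose rho : {measure set BR -> \bar R} := mscale (NngNum ai_ge0)
  (measure_add nu1 (mscale (NngNum c_ge0) (\d_(1%R : BR)))).
have rhoE (A : set BR) :
    rho A = a^-1%:E * (nu1 A + (a - fine J)%:E * \d_(1%R : BR) A).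
  exact: congr1 (measure_addE _ _ _).
have nu1T : nu1 [set: BR] = J.
  rewrite nu1E [RHS]integral_mkcond; apply: eq_integral => t _.
  by rewrite /w !patchE; case: ifPn.
have [|P PE] := measure_probability _ _ _ rho.
  rewrite rhoE nu1T diracT mule1 -(fineK Jfin) -EFinD addrC subrK -EFinM mulVf//.
  by rewrite gt_eqF.
exists P; split.
  apply: etrans (PE _) _; rewrite rhoE nu1E integral0_eq ?add0e.
    rewrite diracE memNset ?mule0//= in_itv/= ltNge ler01//.
  move=> t /=; rewrite in_itv/= => t0; rewrite /w patchE memNset//= in_itv/= andbT.
  by apply/negP; rewrite -leNgt (le_trans (ltW t0)).
move=> A mA A0.
have -> : \int[P]_(t in A) (t ^+ k.+1)%:E = \int[rho]_(t in A) (t ^+ k.+1)%:E.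
  by apply: eq_measure_integral => B _ _; exact: PE.
have X0 t : A t -> 0 <= (t ^+ k.+1)%:E.
  by move=> /A0/=; rewrite in_itv/= andbT => t0; rewrite lee_fin exprn_ge0.
have mX : measurable_fun A (fun t : BR => (t ^+ k.+1)%:E).
  by apply/measurable_EFinP; exact: exprn_measurable.
rewrite (_ : P A = rho A); last exact: PE.
rewrite rhoE divaK ge0_integral_mscale//= divaK ge0_integral_measure_add//.
rewrite ge0_integral_mscale//= integral_dirac// expr1n mule1 addeAC; congr (_ + _).
have wX0 t : A t -> 0 <= (w t)%:E by rewrite lee_fin.
rewrite (@ge0_integral_density _ _ _ nu nu1 A w)//; last exact: measurable_funTS.
have -> : nu A = \int[nu]_(t in A) (\1_(`]1%R, +oo[%classic : set BR) t)%:E.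
  rewrite integral_indic//.
  rewrite [LHS](measureDI nu mA (measurable_itv `]1%R, +oo[)).
  rewrite [X in X + _](_ : _ = 0) ?add0e 1?setIC//.
  apply: (@subset_measure0 _ _ _ nu _ `[0%R, 1%R]%classic) => //.
    exact: measurableD.
  move=> t [/A0 /=]; rewrite !in_itv/= !andbT => -> /negP.
  by rewrite -leNgt.
rewrite nu1E -ge0_integralD//; last first.
  by apply/measurable_EFinP; exact: measurable_indic.
apply: eq_integral => t _; rewrite /w patchE indicE.
case: ifPn => [/[!inE] t1|_]; last by rewrite adde0 mule0.
rewrite -EFinD -EFinM; congr _%:E; have := exprB1_gt0 t t1.
set x := (t ^+ _)%R => /lt0r_neq0 x0.
by apply: (mulIf x0); rewrite mulrDl mulfVK// mulVf// mul1r addrC subrK.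
Qed.

End Trunk.

(** * The tree, its masses and the consistency condition *)

Section Tree.
Context {eta : option nat} {kappa : nat}.
Local Notation X := (X eta kappa).

Lemma phi_preimage_branch (i : J eta) j :
  phi @^-1` [set (branch i j : X)] = [set branch i j.+1].
Proof.
apply/seteqP; split => [[r|[i' [|j']]]|_ ->//] //=.
- by case: ifP.
- by move=> [-> ->].
Qed.

Lemma phi_preimage_trunk (r : nat) (rk : (r < kappa)%N) :
  phi @^-1` [set (trunk (inord r) : X)] = [set trunk (inord r.+1)].
Proof.
have rk1 : (r < kappa.+1)%N by rewrite ltnS ltnW.
apply/seteqP; split => [[s|[i' [|j']]]|_ ->] //=.
- case: ifP => [_ [/(congr1 val)] /=|s0 [/(congr1 val)] /=].
    by rewrite inordK // => kr; rewrite kr ltnn in rk.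
  rewrite !inordK //; last first.
    by rewrite (leq_trans _ (ltn_ord s))// ltnS leq_pred.
  move=> sr; congr (inl _); apply/val_inj; rewrite /= inordK// -sr prednK//.
  by rewrite lt0n; apply: contraFN s0 => /eqP s0; apply/eqP/val_inj.
- move=> [/(congr1 val)] /=.
  by rewrite inordK // => kr; rewrite kr ltnn in rk.
- rewrite ifF; last by apply/negbTE/eqP => /(congr1 val) /=; rewrite inordK.
  by rewrite inordK.
Qed.

Lemma phi_preimage_top :
  phi @^-1` [set (trunk ord_max : X)] =
  [set trunk ord0] `|` [set branch i 0%N | i in [set: J eta]].
Proof.
apply/seteqP; split => [[s|[i [|j]]]|x [->|[i _ <-]]] //=.
- case: ifP => [/eqP -> _|s0 [/(congr1 val)] /=]; first by left.
  have s_gt0 : (0 < s)%N.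
    by rewrite lt0n; apply: contraFN s0 => /eqP s0; apply/eqP/val_inj.
  rewrite inordK; last by rewrite (leq_trans _ (ltn_ord s))// ltnS leq_pred.
  move=> sk; have : (s.-1 < kappa)%N by rewrite prednK// -ltnS.
  by rewrite sk ltnn.
- by move=> _; right; exists i.
Qed.

Lemma phi_iter_preimage (i : J eta) n j :
  iter n phi @^-1` [set (branch i j : X)] = [set branch i (n + j)].
Proof.
elim: n => [|n IH]; first by rewrite preimage_id.
rewrite (_ : iter n.+1 phi = iter n phi \o phi); last first.
  by apply/funext => x; rewrite iterSr.
by rewrite comp_preimage IH phi_preimage_branch.
Qed.

Lemma range_phi (x : X) : range phi x.
Proof.
case: x => [r|[i j]]; last by exists (branch i j.+1).
have [rk|] := ltnP r kappa.
  exists (trunk (inord r.+1)) => //.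
  have : (phi @^-1` [set (trunk (inord r) : X)]) (trunk (inord r.+1)).
    by rewrite phi_preimage_trunk.
  by rewrite /= => ->; rewrite inord_val.
move=> kr; exists (trunk ord0) => //=; congr inl; apply/val_inj => /=.
by apply/eqP; rewrite eqn_leq kr -ltnS ltn_ord.
Qed.

Context {R : realType} (mu : {measure set X -> \bar R}).
Hypothesis mu_discrete : discrete_measure mu.

Definition mass (x : X) : R := fine (mu [set x]).

(** Each point lies in a set of finite measure, by sigma-finiteness. *)
Lemma massE x : mu [set x] = (mass x)%:E.
Proof.
case: mu_discrete => -[F FT /all_and2[mF Foo]] _.
have [n _ Fx] : (\bigcup_n F n) x by rewrite -FT.
rewrite /mass fineK// ge0_fin_numE// (le_lt_trans _ (Foo n))//.
by apply: le_measure; rewrite ?inE// => y ->.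
Qed.

Lemma mass_gt0 x : (0 < mass x)%R.
Proof. by rewrite -lte_fin -massE; case: mu_discrete. Qed.

Lemma h_branch n i : h_ mu phi n (branch i 0%N) =
  (mass (branch i n) / mass (branch i 0%N))%:E.
Proof.
rewrite /h_ phi_iter_preimage addn0 !massE inver gt_eqF ?mass_gt0//.
Qed.

(** The consistency condition, spelled out at the three kinds of points (on a
    branch, on the trunk below x_kappa, and x_kappa itself) and cleared of its
    denominator. *)
Lemma CC_tree (P : X -> probability (measurableTypeR R) R) :
  CC mu phi P <->
  forall A : set (measurableTypeR R), measurable A -> A `<=` `[0%R, +oo[%classic ->
  [/\ forall i j, (mass (branch i j.+1))%:E * P (branch i j.+1) A =
        (mass (branch i j))%:E * \int[P (branch i j)]_(t in A) t%:E,
      forall r, (r < kappa)%N ->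
        (mass (trunk (inord r.+1)))%:E * P (trunk (inord r.+1)) A =
        (mass (trunk (inord r)))%:E * \int[P (trunk (inord r))]_(t in A) t%:E &
      (mass (trunk ord0))%:E * P (trunk ord0) A +
      \esum_(i in [set: J eta])
         ((mass (branch i 0%N))%:E * P (branch i 0%N) A) =
      (mass (trunk ord_max))%:E * \int[P (trunk ord_max)]_(t in A) t%:E].
Proof.
have CCE x A : ((mu [set x])^-1 *
      (\esum_(y in phi @^-1` [set x]) (mu [set y] * P y A))
    = \int[P x]_(t in A) t%:E) <->
   (\esum_(y in phi @^-1` [set x]) ((mass y)%:E * P y A)) =
   (mass x)%:E * \int[P x]_(t in A) t%:E.
  under eq_esum do rewrite massE.
  rewrite massE inver gt_eqF ?mass_gt0//.
  have m0 := mass_gt0 x; have mn0 : mass x != 0%R by rewrite gt_eqF.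
  split => [<-|->]; rewrite muleA -EFinM ?mulVf ?divff ?mul1e//.
have m_ge0 y A : 0 <= (mass y)%:E * P y A.
  by rewrite mule_ge0// lee_fin ltW// mass_gt0.
have topE A : \esum_(y in phi @^-1` [set trunk ord_max]) ((mass y)%:E * P y A) =
      (mass (trunk ord0))%:E * P (trunk ord0) A +
      \esum_(i in [set: J eta])
         ((mass (branch i 0%N))%:E * P (branch i 0%N) A).
  rewrite phi_preimage_top (esumID [set trunk ord0])//; congr (_ + _).
    by rewrite setUK esum_set1.
  rewrite setIUl setICr set0U setIidl; last by move=> _ [i _ <-].
  by rewrite esum_image// => i j _ _ [].
split => [cc A mA A0|tree x A _ mA A0].
  have {}cc x := (CCE x A).1 (cc x A (range_phi x) mA A0).
  split => [i j|r rk|].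
  - by rewrite -cc phi_preimage_branch esum_set1.
  - by rewrite -cc phi_preimage_trunk// esum_set1.
  - by rewrite -cc topE.
apply/CCE; have [br tr top] := tree A mA A0.
case: x => [r|[i j]]; last by rewrite phi_preimage_branch esum_set1// br.
have [rk|kr] := ltnP r kappa.
  by rewrite -(inord_val r) phi_preimage_trunk// esum_set1// tr.
have -> : r = ord_max by apply/val_inj/eqP; rewrite eqn_leq kr -ltnS ltn_ord.
by rewrite topE top.
Qed.

End Tree.

(** * Necessity and sufficiency *)

Section Assembly.
Context {eta : option nat} {kappa : nat} {R : realType}.
Local Notation X := (X eta kappa).
Local Notation BR := (measurableTypeR R).
Context (mu : {measure set X -> \bar R}).
Hypothesis mu_discrete : discrete_measure mu.
Local Notation m := (mass mu).
Local Notation m_gt0 := (mass_gt0 mu mu_discrete).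

(** The integral formula is part of the definition, so that [nu] is known by it
    and not by its construction as a series. *)
Definition branch_total (Q : J eta -> probability BR R)
    (nu : {measure set BR -> \bar R}) :=
  (forall A, nu A = \esum_(i in [set: J eta]) ((m (branch i 0%N))%:E * Q i A)) /\
  forall D f, measurable D -> measurable_fun D f -> (forall t, D t -> 0 <= f t) ->
    \int[nu]_(t in D) f t =
    \esum_(i in [set: J eta]) ((m (branch i 0%N))%:E * \int[Q i]_(t in D) f t).

Lemma branch_total_exists Q : exists nu, branch_total Q nu.
Proof.
have m_ge0 i : (0 <= m (branch i 0%N))%R by rewrite ltW// m_gt0.
have [nu [nuE nuI]] := esum_measure _ _ R _
  (fun i => mscale (NngNum (m_ge0 i)) (Q i) : {measure set BR -> \bar R}).
exists nu; split => [A|D f mD mf f0]; first exact: nuE.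
rewrite nuI//; apply: eq_esum => i _; exact: ge0_integral_mscale.
Qed.

Section Total.
Variables (Q : J eta -> probability BR R) (nu : {measure set BR -> \bar R}).
Hypothesis totalE : branch_total Q nu.

Lemma branch_total_null (A : set BR) :
  nu A = 0 <-> forall i, Q i A = 0.
Proof.
have [nuE _] := totalE; rewrite nuE.
have ge0 i : 0 <= (m (branch i 0%N))%:E * Q i A.
  by rewrite mule_ge0// lee_fin ltW// m_gt0.
split => [+ i|Q0]; last by rewrite esum1// => i _; rewrite Q0 mule0.
rewrite (esumID [set i])// setTI esum_set1// => /eqP.
rewrite padde_eq0//; last exact: esum_ge0.
by rewrite mule_eq0 eqe gt_eqF ?m_gt0//= => /andP[/eqP].
Qed.

(** Brings the sums in [cond_c] and [cond_d] to a single integral against [nu]. *)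
Lemma branch_total_integral (f : BR -> \bar R) x : nu `[0%R, 1%R]%classic = 0 ->
  measurable_fun setT f -> (forall t, `]1%R, +oo[%classic t -> 0 <= f t) ->
  \esum_(i in [set: J eta])
    (mu [set branch i 0%N] / mu [set x] * \int[Q i]_(t in `[0%R, +oo[%classic) f t)
  = (m x)^-1%:E * \int[nu]_(t in `]1%R, +oo[%classic) f t.
Proof.
move=> /branch_total_null Q01 mf f0; have [_ nuI] := totalE.
have mx0 : (0 <= (m x)^-1)%R by rewrite invr_ge0 ltW// m_gt0.
have mf1 : measurable_fun (`]1%R, +oo[%classic : set BR) f by exact: measurable_funTS.
rewrite -ge0_integralZl_EFin// nuI//; last 2 first.
- by apply: emeasurable_funM.
- by move=> t t1; rewrite mule_ge0 ?f0.
apply: eq_esum => i _ /=; rewrite (integral_gt1 _ _ (Q01 i))// ge0_integralZl_EFin// muleA.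
by rewrite !(massE mu mu_discrete) inver gt_eqF ?m_gt0.
Qed.

Lemma cond_cE : nu `[0%R, 1%R]%classic = 0 ->
  cond_c mu Q <-> forall r : 'I_kappa.+1, (0 < r)%N ->
    \int[nu]_(t in `]1%R, +oo[%classic) ((t ^+ r - 1) / (t ^+ kappa.+1 - 1))%:E
      + (m (trunk ord0))%:E = (m (trunk r))%:E.
Proof.
move=> nu01.
suff E (r : 'I_kappa.+1) :
   (\esum_(i in [set: J eta])
      (mu [set branch i 0%N] / mu [set (trunk r : X)] *
       \int[Q i]_(t in `[0%R, +oo[%classic)
          ((t ^+ r - 1) / (t ^+ kappa.+1 - 1))%:E))
    + mu [set trunk ord0] / mu [set (trunk r : X)] =
   (m (trunk r))^-1%:E * (\int[nu]_(t in `]1%R, +oo[%classic) ((t ^+ r - 1) / (t ^+ kappa.+1 - 1))%:E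
      + (m (trunk ord0))%:E).
  have m0 r : m (trunk r) != 0%R by rewrite gt_eqF ?m_gt0.
  split => H r r0; have := H r r0; rewrite E.
    move=> /(congr1 (fun z => (m (trunk r))%:E * z)).
    by rewrite muleA -EFinM mulfV// mul1e mule1.
  by move=> ->; rewrite -EFinM mulVf.
have g0 t : `]1%R, +oo[%classic t -> (0 <= (t ^+ r - 1) / (t ^+ kappa.+1 - 1) :> R)%R.
  rewrite /= in_itv/= andbT => t1.
  by rewrite divr_ge0// subr_ge0 exprn_ege1// ltW.
rewrite branch_total_integral//; last first.
  by apply/measurable_EFinP; exact: measurable_quot.
rewrite [RHS]ge0_muleDr ?integral_ge0//; last first.
  by rewrite lee_fin ltW// m_gt0.
congr (_ + _); rewrite !(massE mu mu_discrete) inver gt_eqF ?m_gt0//.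
by rewrite muleC.
Qed.

Lemma cond_dE : nu `[0%R, 1%R]%classic = 0 ->
  cond_d mu Q <->
    \int[nu]_(t in `]1%R, +oo[%classic) ((t ^+ kappa.+1 - 1)^-1)%:E
      <= (m (trunk ord0))%:E.
Proof.
move=> nu01; rewrite /cond_d branch_total_integral//; last 2 first.
- by apply/measurable_EFinP; exact: measurable_inv_exprB1.
- move=> t /=; rewrite in_itv/= andbT => t1.
  by rewrite lee_fin invr_ge0 subr_ge0 exprn_ege1// ltW.
have m0 := m_gt0 (trunk ord0).
by rewrite muleC -lee_pdivlMr ?invr_gt0// invrK mul1e.
Qed.

End Total.

Let inord_max : inord kappa = ord_max :> 'I_kappa.+1.
Proof. by apply/val_inj; rewrite /= inordK. Qed.

Let inord_0 : inord 0 = ord0 :> 'I_kappa.+1.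
Proof. by apply/val_inj; rewrite /= inordK. Qed.

Section Necessity.
Variable P : X -> probability BR R.
Hypotheses (P_ge0 : forall x, on_Rplus (P x)) (PCC : CC mu phi P).

Let PRp x : P x `[0%R, +oo[%classic = 1.
Proof. exact: etrans (esym (on_Rplus_setT _ (P_ge0 x))) (probability_setT (P x)). Qed.

Lemma CC_branch_moments i n (A : set BR) :
  measurable A -> A `<=` `[0%R, +oo[%classic ->
  (m (branch i n))%:E * P (branch i n) A =
  (m (branch i 0%N))%:E * \int[P (branch i 0%N)]_(t in A) (t ^+ n)%:E.
Proof.
have step := (CC_tree mu mu_discrete P).1 PCC.
apply: (@chain_moments _ (fun j => m (branch i j)) (fun j => P (branch i j)) n) => //.
  by move=> j; exact: m_gt0.
by move=> j B _ mB B0; have [-> _ _] := step B mB B0.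
Qed.

Lemma CC_trunk_moments n (A : set BR) : (n <= kappa)%N ->
  measurable A -> A `<=` `[0%R, +oo[%classic ->
  (m (trunk (inord n)))%:E * P (trunk (inord n)) A =
  (m (trunk ord0))%:E * \int[P (trunk ord0)]_(t in A) (t ^+ n)%:E.
Proof.
have step := (CC_tree mu mu_discrete P).1 PCC.
move=> nk mA A0; rewrite -inord_0.
apply: (@chain_moments _ (fun j => m (trunk (inord j)))
  (fun j => P (trunk (inord j))) kappa) => //.
  by move=> j; exact: m_gt0.
by move=> j B jk mB B0; have [_ tr _] := step B mB B0; exact: tr.
Qed.

Lemma CC_trunk_equation nu : branch_total (fun i => P (branch i 0%N)) nu ->
  trunk_equation kappa (m (trunk ord0)) (P (trunk ord0)) nu.
Proof.
move=> [nuE _] A mA A0; rewrite nuE.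
have [_ _ ->] := (CC_tree mu mu_discrete P).1 PCC A mA A0.
apply: (@moments_shift _ _ _ kappa) => //.
- by rewrite ltW// m_gt0.
- exact: m_gt0.
- by move=> B mB B0; rewrite -inord_max CC_trunk_moments.
Qed.

Lemma CC_necessary :
  [/\ cond_a mu, cond_b mu (fun i => P (branch i 0%N)),
      cond_c mu (fun i => P (branch i 0%N)) &
      cond_d mu (fun i => P (branch i 0%N))].
Proof.
have [nu nuE] := branch_total_exists (fun i => P (branch i 0%N)).
have eqn := CC_trunk_equation _ nuE.
have m0 := m_gt0 (trunk ord0).
have [nu01 _] := trunk_equation_le1 _ _ m0 _ _ eqn.
have repr i : S_representing (P (branch i 0%N)) (fun n => h_ mu phi n (branch i 0%N)).
  split => // n; rewrite h_branch//; split => //.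
  have := CC_branch_moments i n _ (measurable_itv _) (@subset_refl _ _).
  rewrite PRp mule1 => /(congr1 (fun z => (m (branch i 0%N))^-1%:E * z)).
  by rewrite muleA -!EFinM mulVf ?gt_eqF ?m_gt0// mul1e mulrC.
split.
- by move=> i; exists (P (branch i 0%N)).
- by move=> i; split => //; exact: (branch_total_null _ _ nuE _).1 nu01 i.
- apply/(cond_cE _ _ nuE nu01) => r _.
  rewrite (trunk_equation_moment _ _ m0 _ _ _ eqn)//.
  rewrite -CC_trunk_moments//; last by rewrite -ltnS.
  by rewrite PRp mule1 inord_val.
- by apply/(cond_dE _ _ nuE nu01); exact: (trunk_equation_inv _ _ m0 _ _ eqn).
Qed.

End Necessity.

Lemma CC_sufficient (Q : J eta -> probability BR R) :
  (forall i, on_Rplus (Q i)) -> cond_b mu Q -> cond_c mu Q -> cond_d mu Q ->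
  exists P : X -> probability BR R,
    [/\ forall x, on_Rplus (P x), forall i, P (branch i 0%N) = Q i & CC mu phi P].
Proof.
move=> Q0 Qb Qc Qd.
have [nu nuE] := branch_total_exists Q.
have nu01 : nu `[0%R, 1%R]%classic = 0.
  by apply/(branch_total_null _ _ nuE) => i; have [] := Qb i.
have m0 := m_gt0 (trunk ord0).
(* [P0] is the measure at x_0; all the others are derived from it and [Q]. *)
have [P0 [P0_ge0 P0E]] := trunk_equation_solution _ _ m0 _ nu01
  ((cond_dE _ _ nuE nu01).1 Qd).
have /choice[Pt PtE] (r : 'I_kappa.+1) : exists Pr : probability BR R,
    on_Rplus Pr /\
    forall A : set BR, measurable A -> A `<=` `[0%R, +oo[%classic ->
    (m (trunk r))%:E * Pr A =
    (m (trunk ord0))%:E * \int[P0]_(t in A) (t ^+ r)%:E.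
  apply: tilted_probability; [exact: ltW|exact: m_gt0|].
  rewrite -(trunk_equation_moment _ _ m0 _ _ P0_ge0 P0E).
  have [r0|r_gt0] := posnP r; last exact: (cond_cE _ _ nuE nu01).1.
  (* [cond_c] starts at r = 1; for r = 0 the integrand is zero. *)
  have -> : r = ord0 by exact/val_inj.
  rewrite integral0_eq ?add0e// => t _.
  by rewrite expr0 subrr mul0r.
have /choice[Pb PbE] (ij : J eta * nat) : exists Pij : probability BR R,
    on_Rplus Pij /\
    forall A : set BR, measurable A -> A `<=` `[0%R, +oo[%classic ->
    (m (branch ij.1 ij.2))%:E * Pij A =
    (m (branch ij.1 0%N))%:E * \int[Q ij.1]_(t in A) (t ^+ ij.2)%:E.
  case: ij => i j.
  apply: tilted_probability; [exact/ltW/m_gt0|exact: m_gt0|].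
  have [[_ /(_ j)[_ /= hE]] _] := Qb i; rewrite -hE h_branch//.
  by rewrite -EFinM mulrCA mulfV ?mulr1// gt_eqF ?m_gt0.
(* At j = 0 the measure has to be [Q i] itself, not merely agree with it. *)
pose P (x : X) : probability BR R :=
  match x with inl r => Pt r | inr (i, 0%N) => Q i | inr ij => Pb ij end.
have PbrE i j (A : set BR) : measurable A -> A `<=` `[0%R, +oo[%classic ->
    (m (branch i j))%:E * P (branch i j) A =
    (m (branch i 0%N))%:E * \int[Q i]_(t in A) (t ^+ j)%:E.
  case: j => [|j] mA A0; last exact: (PbE (i, j.+1)).2.
  under eq_integral do rewrite expr0.
  by rewrite integral_cst// mul1e.
exists P; split => //.
  by case=> [r|[i [|j]]]; [exact: (PtE r).1|exact: Q0|exact: (PbE (i, j.+1)).1].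
apply/(CC_tree mu mu_discrete) => A mA A0; split.
- move=> i j; rewrite PbrE//; apply/esym/moments_shift => //.
  + exact/ltW/m_gt0.
  + exact: m_gt0.
  + by move=> B mB B0; exact: PbrE.
- move=> r rk; rewrite /= (PtE _).2// inordK//.
  apply/esym/moments_shift => //.
  + exact/ltW/m_gt0.
  + exact: m_gt0.
  + by move=> B mB B0; rewrite (PtE _).2// inordK// ltnS ltnW.
- have [nuA _] := nuE; rewrite /= -nuA (PtE _).2//.
  under eq_integral do rewrite expr0.
  rewrite integral_cst// mul1e P0E//; apply/esym/moments_shift => //.
  + exact/ltW/m_gt0.
  + exact: m_gt0.
  + by move=> B mB B0; exact: (PtE ord_max).2.
Qed.

End Assembly.

Theorem theorem4p4p1 (R : realType) (eta : option nat) (kappa : nat)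
    (eta_gt0 : eta <> Some 0%N)
    (mu : {measure set (X eta kappa) -> \bar R})
    (mu_discrete : discrete_measure mu)
    (mu_dense : comp_op_densely_defined mu phi) :
  (forall P : X eta kappa -> probability (measurableTypeR R) R,
      (forall x, on_Rplus (P x)) ->
      CC mu phi P ->
      [/\ cond_a mu,
          cond_b mu (fun i => P (branch i 0%N)),
          cond_c mu (fun i => P (branch i 0%N)) &
          cond_d mu (fun i => P (branch i 0%N))])
  /\
  (cond_a mu ->
   forall Q : J eta -> probability (measurableTypeR R) R,
      (forall i, on_Rplus (Q i)) ->
      cond_b mu Q -> cond_c mu Q -> cond_d mu Q ->
      exists P : X eta kappa -> probability (measurableTypeR R) R,
        [/\ forall x, on_Rplus (P x),
            forall i, P (branch i 0%N) = Q i &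
            CC mu phi P]).
Proof.
split => [P P_ge0 PCC|_ Q Q_ge0 Qb Qc Qd]; first exact: CC_necessary.
exact: CC_sufficient.
Qed.
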